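(* A subset $S$ of a b-bounded b-convex body $K$ in a strictly convex Minkowski space $(\mathbb{R}^n,\|\cdot\|)$ satisfies $\operatorname{bh}_1(S)=K$ if and only if $\operatorname{b-exp}(K) \subseteq \operatorname{cl}(S)$. In particular, $$K=\operatorname{bh}_1(\operatorname{b-exp}(K)),$$ and $\operatorname{cl}(\operatorname{b-exp}(K))$ is the unique minimal (under inclusion) closed subset of $\mathbb{R}^n$ whose ball hull is $K$.
   Context: A Minkowski space $(\mathbb{R}^n,\|\cdot\|)$ is $\mathbb{R}^n$, $n\ge 1$, equipped with an arbitrary norm; it is strictly convex if the boundary of the unit ball contains no segment $[x_1,x_2]$ with $x_1\neq x_2$. For $x\in\mathbb{R}^n$ and $r\ge 0$, $B(x,r)=\{y:\|y-x\|\le r\}$ is the closed ball and $S(x,r)=\{y:\|y-x\|=r\}$ the sphere; $\operatorname{cl}$ denotes closure. The ball hull of $S\subseteq\mathbb{R}^n$ is $\operatorname{bh}_1(S)=\bigcap_{x\in\mathbb{R}^n:\,S\subseteq B(x,1)}B(x,1)$, where the intersection of an empty family is $\mathbb{R}^n$. A set $S$ is b-convex if $S=\operatorname{bh}_1(S)$; a b-convex body is a bounded non-empty b-convex set. A supporting sphere of a b-convex body $K$ is a sphere $S(x,1)$ of radius $1$ with $K\subseteq B(x,1)$ and $K\cap S(x,1)\neq\emptyset$; the set $K\cap S(x,1)$ is then called an exposed b-face of $K$. If an exposed b-face is a singleton $\{x_0\}$, then $x_0$ is a b-exposed point of $K$; $\operatorname{b-exp}(K)$ is the set of all b-exposed points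 of $K$. The circumradius $\operatorname{rad}(S)$ is the least $r\ge 0$ such that $S$ is contained in some ball $B(x,r)$ (and $+\infty$ if $S$ is unbounded). A set $S$ is b-bounded if $\operatorname{rad}(S)<1$. *)

(* Defs.v *)
From HB Require Import structures.
From mathcomp Require Import all_boot all_order all_algebra.
From mathcomp Require Import all_classical all_reals all_analysis.
Import Order.TTheory GRing.Theory Num.Theory numFieldNormedType.Exports.
Set Implicit Arguments.
Unset Strict Implicit.
Unset Printing Implicit Defensive.
Local Open Scope classical_set_scope.
Local Open Scope ring_scope.

(* The arbitrary norm of a Minkowski space is a function nu on 'rV[R]_n and not
   the canonical norm `|_| of 'rV[R]_n, which is the sup norm. Topological
   notions (closure, interior, closed) refer to the standard topology of
   'rV[R]_n; metric notions (balls, spheres, boundedness) refer to nu. *)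
Record is_norm (R : realType) (n : nat) (nu : 'rV[R]_n -> R) : Prop := IsNorm {
  norm_eq0_imp : forall x, nu x = 0 -> x = 0 ;
  norm_homog : forall (a : R) x, nu (a *: x) = `|a| * nu x ;
  norm_triangle : forall x y, nu (x + y) <= nu x + nu y }.

Definition cball (R : realType) (n : nat) (nu : 'rV[R]_n -> R)
    (x : 'rV[R]_n) (r : R) : set 'rV[R]_n :=
  closed_ball_ nu x r.

Definition sphere (R : realType) (n : nat) (nu : 'rV[R]_n -> R)
    (x : 'rV[R]_n) (r : R) : set 'rV[R]_n :=
  [set y | nu (x - y) = r].

Definition boundary (T : topologicalType) (A : set T) : set T :=
  closure A `\` interior A.

Definition segment (R : realType) (n : nat) (x1 x2 : 'rV[R]_n) :
    set 'rV[R]_n :=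
  [set (1 - t) *: x1 + t *: x2 | t in `[0, 1]].

Definition strictly_convex (R : realType) (n : nat) (nu : 'rV[R]_n -> R) :
    Prop :=
  forall x1 x2 : 'rV[R]_n,
    x1 <> x2 -> ~ (segment x1 x2 `<=` boundary (cball nu 0 1)).

(* \bigcap over an empty index set is setT *)
Definition ball_hull (R : realType) (n : nat) (nu : 'rV[R]_n -> R)
    (S : set 'rV[R]_n) : set 'rV[R]_n :=
  \bigcap_(x in [set x | S `<=` cball nu x 1]) cball nu x 1.

Definition b_convex (R : realType) (n : nat) (nu : 'rV[R]_n -> R)
    (S : set 'rV[R]_n) : Prop :=
  S = ball_hull nu S.

Definition norm_bounded (R : realType) (n : nat) (nu : 'rV[R]_n -> R)
    (S : set 'rV[R]_n) : Prop :=
  exists r : R, S `<=` cball nu 0 r.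

Definition b_convex_body (R : realType) (n : nat) (nu : 'rV[R]_n -> R)
    (K : set 'rV[R]_n) : Prop :=
  [/\ norm_bounded nu K, K !=set0 & b_convex nu K].

(* A sphere of radius 1 is represented by its center x. *)
Definition supporting_sphere (R : realType) (n : nat) (nu : 'rV[R]_n -> R)
    (K : set 'rV[R]_n) (x : 'rV[R]_n) : Prop :=
  K `<=` cball nu x 1 /\ K `&` sphere nu x 1 !=set0.

Definition exposed_b_face (R : realType) (n : nat) (nu : 'rV[R]_n -> R)
    (K F : set 'rV[R]_n) : Prop :=
  exists2 x, supporting_sphere nu K x & F = K `&` sphere nu x 1.

Definition b_exp (R : realType) (n : nat) (nu : 'rV[R]_n -> R)
    (K : set 'rV[R]_n) : set 'rV[R]_n :=
  [set x0 | exposed_b_face nu K [set x0]].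

(* The infimum is attained when S is bounded, since the space is
   finite-dimensional; the infimum of the empty set, i.e., for S unbounded,
   is +oo. *)
Definition rad (R : realType) (n : nat) (nu : 'rV[R]_n -> R)
    (S : set 'rV[R]_n) : \bar R :=
  ereal_inf [set r%:E | r in
    [set r : R | 0 <= r /\ exists x, S `<=` cball nu x r]].

Definition b_bounded (R : realType) (n : nat) (nu : 'rV[R]_n -> R)
    (S : set 'rV[R]_n) : Prop :=
  (rad nu S < 1%:E)%E.

Definition minimal_closed_generator (R : realType) (n : nat)
    (nu : 'rV[R]_n -> R) (K C : set 'rV[R]_n) : Prop :=
  [/\ closed C, ball_hull nu C = K &
      forall D, closed D -> ball_hull nu D = K -> D `<=` C -> D = C].

(* Main.v *)
Require Import Defs.
From HB Require Import structures.
From mathcomp Require Import all_boot all_order all_algebra.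
From mathcomp Require Import all_classical all_reals all_analysis.
From mathcomp Require Import ring lra.
Import Order.TTheory GRing.Theory Num.Theory numFieldNormedType.Exports.
Set Implicit Arguments.
Unset Strict Implicit.
Local Open Scope classical_set_scope.
Local Open Scope ring_scope.

(** Everything follows from the equivalence for subsets [S] of [K].

    If [ball_hull nu S = K], a b-exposed point [x0], with [K] meeting the sphere around
    [x] only at [x0], has to lie in [closure S]. Otherwise the compact set
    [closure S] stays at distance at most [1 - d] from [x], for some [d > 0],
    so the unit ball can be shifted by [d (x - x0)], away from [x0], and still
    contain [S]; then [x0] is not in the ball hull of [S] ([b_exp_sub_closure]).

    For the converse, let a unit ball around [c] contain [S], hence also
    [b_exp K], and suppose that it misses a point of [K]. The contradiction is
    a b-exposed point of [K] outside that ball, found as a farthest point: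

    - if the distance [r] from [x] to a farthest point [y] of [K] satisfies
      [0 < r < 1], then [y] is b-exposed: the ball of radius [r] around [x],
      which contains [K], is internally tangent at [y] to a unit ball, and by
      strict convexity [y] is the only contact point ([farthest_b_exp]);
    - since [K] lies in a ball of radius [r < 1] around some [z], the farthest
      distance from [x] to [K] is at most [r < 1] for [x = z] and exceeds [1]
      for [x = c]. Moving [x] from [z] to [c], one reaches a point where that
      distance is below [1] but so large that convexity of the norm puts the
      farthest point at distance more than [1] from [c]
      ([exists_b_exp_outside_ball]).

    The topological input is that closed sets bounded for the given norm are
    compact, by comparison with the sup norm. *)

(** * Elementary properties of a norm *)

Lemma is_norm0 (R : realType) (n : nat) (nu : 'rV[R]_n -> R) :
  is_norm nu -> nu 0 = 0.
Proof. by move=> hnu; rewrite -(scale0r 0) (norm_homog hnu) normr0 mul0r. Qed.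

Lemma is_normN (R : realType) (n : nat) (nu : 'rV[R]_n -> R) x :
  is_norm nu -> nu (- x) = nu x.
Proof. by move=> hnu; rewrite -scaleN1r (norm_homog hnu) normrN1 mul1r. Qed.

Lemma is_norm_distC (R : realType) (n : nat) (nu : 'rV[R]_n -> R) x y :
  is_norm nu -> nu (x - y) = nu (y - x).
Proof. by move=> hnu; rewrite -(is_normN _ hnu) opprB. Qed.

Lemma is_norm_ge0 (R : realType) (n : nat) (nu : 'rV[R]_n -> R) x :
  is_norm nu -> 0 <= nu x.
Proof.
move=> hnu; have := norm_triangle hnu x (- x).
by rewrite subrr (is_norm0 hnu) (is_normN _ hnu); lra.
Qed.

Lemma is_norm_convex (R : realType) (n : nat) (nu : 'rV[R]_n -> R) (t : R) x y :
  is_norm nu -> 0 <= t <= 1 ->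
  nu ((1 - t) *: x + t *: y) <= (1 - t) * nu x + t * nu y.
Proof.
move=> hnu /andP[t0 t1]; apply: le_trans (norm_triangle hnu _ _) _.
by rewrite !(norm_homog hnu) !ger0_norm // subr_ge0.
Qed.

Lemma is_norm_lipschitz (R : realType) (n : nat) (nu : 'rV[R]_n -> R) x y :
  is_norm nu -> `|nu x - nu y| <= nu (x - y).
Proof.
move=> hnu; have := norm_triangle hnu (x - y) y.
have := norm_triangle hnu (y - x) x.
by rewrite !subrK (is_norm_distC y x hnu) ler_norml; lra.
Qed.

(** * Comparison with the sup norm *)

Lemma is_norm_le_sup (R : realType) (n : nat) (nu : 'rV[R]_n -> R) :
  is_norm nu -> exists2 k : R, 0 < k & forall x, nu x <= k * `|x|.
Proof.
move=> hnu; exists (1 + \sum_(i < n) nu 'e_i).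
  by rewrite ltr_pwDl // sumr_ge0 // => i _; exact: is_norm_ge0.
move=> x; rewrite [in X in nu X](row_sum_delta x).
have nu_sum (F : 'I_n -> 'rV[R]_n) :
    nu (\sum_(i < n) F i) <= \sum_(i < n) nu (F i).
  apply: (big_ind2 (fun a b => nu a <= b)) => [|a b c d ab cd|//].
    by rewrite (is_norm0 hnu).
  by apply: le_trans (norm_triangle hnu _ _) _; exact: lerD.
apply: le_trans (nu_sum _) _.
rewrite mulrDl mul1r mulr_suml ler_wpDl // ler_sum // => i _.
rewrite (norm_homog hnu) mulrC ler_wpM2l ?is_norm_ge0 //.
rewrite {2}/Num.norm /= mx_normrE.
exact: (le_bigmax (0 : R) (fun ij : 'I_1 * 'I_n => `|x ij.1 ij.2|) (0, i)).
Qed.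

Lemma lipschitz_continuous (R : realType) (V W : normedModType R)
    (f : V -> W) (k : R) :
  0 < k -> (forall x y, `|f x - f y| <= k * `|x - y|) -> continuous f.
Proof.
move=> k0 lf x; apply/cvgrPdist_lt => e e0; near=> y.
apply: le_lt_trans (lf _ _) _; rewrite mulrC -ltr_pdivlMr //.
near: y; apply: (@cvgr_dist_lt _ _ _ (nbhs x) _ id).
  exact: cvg_id.
exact: divr_gt0.
Unshelve. all: by end_near. Qed.

Lemma is_norm_continuous (R : realType) (n : nat) (nu : 'rV[R]_n -> R) :
  is_norm nu -> continuous nu.
Proof.
move=> hnu; have [k k0 lek] := is_norm_le_sup hnu.
apply: (@lipschitz_continuous R 'rV[R]_n R^o nu k) => // x y.
exact: le_trans (is_norm_lipschitz x y hnu) (lek _).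
Qed.

Lemma dist_continuous (R : realType) (n : nat) (nu : 'rV[R]_n -> R)
    (x : 'rV[R]_n) :
  is_norm nu -> continuous (fun y : 'rV[R]_n => nu (x - y)).
Proof.
move=> hnu y.
apply: (@continuous_comp _ _ _ (fun y : 'rV[R]_n => x - y) nu).
  apply: (@continuousB _ _ _ (fun=> x) id); first exact: cst_continuous.
  exact: cvg_id.
exact: is_norm_continuous.
Qed.

Lemma closed_cball (R : realType) (n : nat) (nu : 'rV[R]_n -> R) x r :
  is_norm nu -> closed (cball nu x r).
Proof.
move=> hnu.
have -> : cball nu x r = (fun y => nu (x - y)) @^-1` [set s | s <= r] by [].
apply: preimage_closed; last exact: closed_le.
by move=> y _; exact: dist_continuous.
Qed.

(** The constant is the minimum of [nu] over the sup-norm unit sphere, which is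
    compact. *)
Lemma is_norm_ge_sup (R : realType) (n : nat) (nu : 'rV[R]_n -> R) :
  is_norm nu -> exists2 m : R, 0 < m & forall x, m * `|x| <= nu x.
Proof.
move=> hnu; pose U := [set x : 'rV[R]_n | `|x| = 1].
have unitU x : x != 0 -> U (`|x|^-1 *: x).
  move=> x0; rewrite /U /= normrZ normfV normr_id mulVf //.
  by rewrite normr_eq0.
have cU : compact U.
  apply: bounded_closed_compact.
    by exists 1; split=> // M M1 x /= ->; exact: ltW.
  have -> : U = Num.norm @^-1` [set 1] by [].
  apply: preimage_closed; last exact: closed_eq.
  by move=> x _; exact: norm_continuous.
have [U0|/set0P/negP] := pselect (U !=set0); last first.
  (* an empty unit sphere means dimension 0 *)
  rewrite negbK => /eqP U0; exists 1 => // x.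
  have [->|/unitU] := eqVneq x 0; last by rewrite U0.
  by rewrite normr0 mulr0 is_norm_ge0.
have [u /set_mem Uu umin] := EVT_min_rV U0 cU
  (continuous_subspaceT (is_norm_continuous hnu)).
exists (nu u) => [|x].
  rewrite lt_neqAle is_norm_ge0 // andbT eq_sym; apply/eqP.
  move=> /(norm_eq0_imp hnu) u0; move: Uu.
  by rewrite /U /= u0 normr0 => /esym/eqP; rewrite oner_eq0.
have [->|x0] := eqVneq x 0; first by rewrite normr0 mulr0 is_norm_ge0.
have := umin _ (mem_set (unitU _ x0)).
by rewrite (norm_homog hnu) normfV normr_id mulrC ler_pdivlMr ?normr_gt0.
Qed.

Lemma norm_bounded_closed_compact (R : realType) (n : nat)
    (nu : 'rV[R]_n -> R) (K : set 'rV[R]_n) :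
  is_norm nu -> norm_bounded nu K -> closed K -> compact K.
Proof.
move=> hnu [r Kr] cK; apply: bounded_closed_compact => //.
have [m m0 lem] := is_norm_ge_sup hnu.
exists (r / m); split; first exact: num_real.
move=> M rM x /Kr; rewrite /cball /closed_ball_ /= sub0r is_normN // => xr.
by apply/ltW/(le_lt_trans _ rM); rewrite ler_pdivlMr // mulrC (le_trans (lem x)).
Qed.

(** * Ball hulls *)

Lemma closed_ball_hull (R : realType) (n : nat) (nu : 'rV[R]_n -> R)
    (S : set 'rV[R]_n) : is_norm nu -> closed (ball_hull nu S).
Proof. by move=> hnu; apply: closed_bigI => x _; exact: closed_cball. Qed.

Lemma sub_ball_hull (R : realType) (n : nat) (nu : 'rV[R]_n -> R)
    (S : set 'rV[R]_n) : S `<=` ball_hull nu S.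
Proof. by move=> y Sy x; exact. Qed.

Lemma ball_hullS (R : realType) (n : nat) (nu : 'rV[R]_n -> R)
    (S T : set 'rV[R]_n) : S `<=` T -> ball_hull nu S `<=` ball_hull nu T.
Proof. by move=> ST y yS x Tx; apply: yS; exact: subset_trans Tx. Qed.

(** * Strict convexity and farthest points *)

Lemma compact_farthest (R : realType) (n : nat) (nu : 'rV[R]_n -> R)
    (K : set 'rV[R]_n) x : is_norm nu -> compact K -> K !=set0 ->
  exists2 y, K y & forall z, K z -> nu (x - z) <= nu (x - y).
Proof.
move=> hnu cK K0.
have [y /set_mem Ky ymax] := EVT_max_rV K0 cK
  (continuous_subspaceT (dist_continuous (x := x) hnu)).
by exists y => // z /mem_set/ymax.
Qed.

(** Scaling a unit vector [u] by a factor slightly above 1 leaves the unit ball,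
    so [u] is not interior to it. *)
Lemma unit_sphere_boundary (R : realType) (n : nat) (nu : 'rV[R]_n -> R) u :
  is_norm nu -> nu u = 1 -> boundary (cball nu 0 1) u.
Proof.
move=> hnu u1; split.
  apply: subset_closure.
  by rewrite /cball /closed_ball_ /= sub0r is_normN // u1.
have u0 : 0 < `|u|.
  rewrite normr_gt0; apply/eqP => u0; move: u1.
  by rewrite u0 is_norm0 // => /esym/eqP; rewrite oner_eq0.
rewrite /interior => /nbhs_normP[e /= e0 sub].
have t0 : 0 < e / 2 / `|u| by rewrite !divr_gt0.
have /sub : ball_ Num.norm u e ((1 + e / 2 / `|u|) *: u).
  rewrite /ball_ /= scalerDl scale1r opprD addrA subrr sub0r normrN normrZ.
  by rewrite gtr0_norm // divfK ?gt_eqF //; lra.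
rewrite /cball /closed_ball_ /= sub0r is_normN // (norm_homog hnu) u1 mulr1.
by rewrite gtr0_norm; lra.
Qed.

(** If the chord from [u] to [v] touches the unit sphere at one inner point [w],
    it lies on the sphere entirely: were [nu p < 1] at some point [p] of it, [w]
    would lie between [p] and one of the endpoints, and convexity would give
    [nu w < 1]. *)
Lemma strictly_convex_eq (R : realType) (n : nat) (nu : 'rV[R]_n -> R)
    (s : R) u v : is_norm nu -> strictly_convex nu ->
  nu u = 1 -> nu v = 1 -> 0 < s < 1 -> nu ((1 - s) *: u + s *: v) = 1 -> u = v.
Proof.
move=> hnu hsc u1 v1 /andP[s0 s1] w1; apply: contrapT => /hsc; apply.
move=> _ [t /= /[!in_itv]/= t01 <-]; apply: unit_sphere_boundary => //.
set p := _ + _; apply/eqP; rewrite eq_le; apply/andP; split.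
  have := is_norm_convex u v hnu t01.
  by rewrite u1 v1; move: t01 => /andP[]; lra.
move: t01 => /andP[t0 t1].
have [ts|st] := ltP t s.
  pose l := (s - t) / (1 - t).
  have l01 : 0 <= l < 1.
    by rewrite divr_ge0 ?ltr_pdivrMr /=; lra.
  have := @is_norm_convex _ _ _ l p v hnu.
  have -> : (1 - l) *: p + l *: v = (1 - s) *: u + s *: v.
    apply/rowP => i; rewrite /p !mxE /l; field; lra.
  rewrite w1 v1; move: l01 => /andP[l0 l1]; rewrite l0 ltW //= => /(_ isT).
  nra.
pose l := s / t.
have l01 : 0 < l <= 1.
  by rewrite divr_gt0 ?ler_pdivrMr /=; lra.
have := @is_norm_convex _ _ _ l u p hnu.
have -> : (1 - l) *: u + l *: p = (1 - s) *: u + s *: v.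
  apply/rowP => i; rewrite /p !mxE /l; field; lra.
rewrite w1 u1; move: l01 => /andP[l0 l1]; rewrite l1 ltW //= => /(_ isT).
nra.
Qed.

(** With [r = nu (x - y)], the unit ball around [c = y + (x - y) / r] contains
    the ball of radius [r] around [x] and touches it at [y]. At a contact point
    [z] the triangle inequality [nu (c - z) <= nu (x - z) + (1 - r)] is an
    equality, which says that a proper convex combination of the unit vectors
    [(x - z) / r] and [(x - y) / r] is again a unit vector; strict convexity
    makes them equal. *)
Lemma farthest_b_exp (R : realType) (n : nat) (nu : 'rV[R]_n -> R)
    (K : set 'rV[R]_n) x y : is_norm nu -> strictly_convex nu ->
  K y -> 0 < nu (x - y) < 1 -> K `<=` cball nu x (nu (x - y)) ->
  b_exp nu K y.
Proof.
move=> hnu hsc Ky /andP[]; set r := nu (x - y) => r0 r1 Kxr.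
pose u := r^-1 *: (x - y); pose c := y + u.
have u1 : nu u = 1.
  by rewrite (norm_homog hnu) gtr0_norm ?invr_gt0 // mulVf // gt_eqF.
have cz z : c - z = (x - z) + (1 - r) *: u.
  apply/rowP => i; rewrite /c /u !mxE; field; lra.
have tri z : nu (c - z) <= nu (x - z) + (1 - r).
  rewrite cz; apply: le_trans (norm_triangle hnu _ _) _.
  by rewrite (norm_homog hnu) u1 mulr1 gtr0_norm // subr_gt0.
have cy : nu (c - y) = 1 by rewrite /c addrAC subrr add0r.
have Kc : K `<=` cball nu c 1.
  move=> z /Kxr; rewrite /cball /closed_ball_ /= => zr.
  by have := tri z; lra.
exists c.
  by split=> //; exists y.
apply/seteqP; split=> [_ -> //|z [Kz /= cz1]].
have zr : nu (x - z) = r.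
  move: cz1 (tri z) (Kxr _ Kz); rewrite /sphere /cball /closed_ball_ /=; lra.
have v1 : nu (r^-1 *: (x - z)) = 1.
  by rewrite (norm_homog hnu) zr gtr0_norm ?invr_gt0 // mulVf // gt_eqF.
have : r^-1 *: (x - z) = u.
  apply: (strictly_convex_eq (s := 1 - r) hnu hsc) => //.
    by apply/andP; split; lra.
  by rewrite opprB addrCA subrr addr0 scalerA divff ?gt_eqF // scale1r -cz.
by move=> /(scalerI (invr_neq0 (lt0r_neq0 r0)))/addrI/oppr_inj ->.
Qed.

(** * b-exposed points and generators *)

(** Let [g x] be the distance from [x] to a farthest point of [K], and move [x]
    along [ct t = z + t (c - z)]. For a farthest point [y] from [ct t],
    convexity gives [g (ct t) <= (1 - t) r + t nu (c - y)], so that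
    [nu (c - y) > 1] as soon as [g (ct t) > (1 - t) r + t]; and
    [farthest_b_exp] applies to [y] when [0 < g (ct t) < 1]. Both hold where
    [g (ct t)] equals [(1 - t) s + t] for some [0 < t < 1], with [s] strictly
    between [r] and [1]. *)
Lemma exists_b_exp_outside_ball (R : realType) (n : nat) (nu : 'rV[R]_n -> R)
    (K : set 'rV[R]_n) z (r : R) c p :
  is_norm nu -> strictly_convex nu -> compact K ->
  K `<=` cball nu z r -> r < 1 -> K p -> 1 < nu (c - p) ->
  exists2 y, b_exp nu K y & 1 < nu (c - y).
Proof.
move=> hnu hsc cK Kr r1 Kp cp.
have K0 : K !=set0 by exists p.
have r0 : 0 <= r by apply: le_trans (Kr _ Kp); exact: is_norm_ge0.
have /choice[far farP] x : exists y, K y /\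
    forall w, K w -> nu (x - w) <= nu (x - y).
  by have [y] := compact_farthest x hnu cK K0; exists y.
pose g x := nu (x - far x).
have gle x x' : g x <= nu (x - x') + g x'.
  have := norm_triangle hnu (x - x') (x' - far x).
  rewrite addrA subrK /g; have := (farP x').2 _ (farP x).1; lra.
pose ct t := z + t *: (c - z).
pose s := (1 + r) / 2.
(* a zero of [phi] in ]0, 1[ is provided by the intermediate value theorem *)
pose phi t := g (ct t) - ((1 - t) * s + t).
have ctE t t' : nu (ct t - ct t') = `|t - t'| * nu (c - z).
  rewrite -(norm_homog hnu); congr nu.
  by apply/rowP => i; rewrite /ct !mxE; ring.
have phic : continuous phi.
  apply: (@lipschitz_continuous R R^o R^o phi (1 + nu (c - z))).
    by rewrite ltr_pwDl // is_norm_ge0.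
  move=> t t'; have := gle (ct t) (ct t'); have := gle (ct t') (ct t).
  rewrite !ctE (distrC t' t) /phi.
  set A := g (ct t); set B := g (ct t'); set N := nu _.
  set D := `|_| * _ => h1 h2.
  have -> : A - ((1 - t) * s + t) - (B - ((1 - t') * s + t')) =
    (A - B) - (1 - s) * (t - t') by ring.
  apply: le_trans (ler_normB _ _) _; rewrite normrM mulrDl mul1r addrC.
  apply: lerD.
    rewrite ler_piMl // ger0_norm /s; lra.
  by rewrite mulrC -/D ler_norml; lra.
have phi0 : phi 0 < 0.
  have /Kr := (farP (ct 0)).1; rewrite /cball /closed_ball_ /=.
  rewrite /phi /g /ct /s scale0r addr0; lra.
have phi1 : 0 < phi 1.
  have := (farP (ct 1)).2 _ Kp; rewrite /phi /g.
  have -> : ct 1 = c by rewrite /ct scale1r addrC subrK.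
  lra.
have [||t] := @IVT _ phi 0 1 0 ler01.
- exact: continuous_subspaceT.
- by rewrite /Num.min /Num.max (lt_trans phi0 phi1) !ltW.
rewrite in_itv /= => /andP[t0 t1] phit.
have {}t0 : 0 < t.
  rewrite lt_neqAle t0 andbT; apply/eqP => t00.
  by move: phi0; rewrite {1}t00 phit ltxx.
have {}t1 : t < 1.
  rewrite lt_neqAle t1 andbT; apply/eqP => t11.
  by move: phi1; rewrite -t11 phit ltxx.
have [] := farP (ct t); set y := far _ => Ky ymax.
have gt : nu (ct t - y) = (1 - t) * s + t.
  by move: phit; rewrite /phi /g -/y; lra.
exists y.
  apply: (@farthest_b_exp _ _ _ _ (ct t)) => //.
  by rewrite gt /s; apply/andP; split; nra.
have := @is_norm_convex _ _ _ t (z - y) (c - y) hnu.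
have -> : (1 - t) *: (z - y) + t *: (c - y) = ct t - y.
  by apply/rowP => i; rewrite /ct !mxE; ring.
rewrite (ltW t0) (ltW t1) gt => /(_ isT).
have := Kr _ Ky; rewrite /cball /closed_ball_ /= /s.
set N := nu _; set M := nu _; nra.
Qed.

Lemma b_bounded_sub_ball (R : realType) (n : nat) (nu : 'rV[R]_n -> R)
    (K : set 'rV[R]_n) :
  b_bounded nu K -> exists z, exists2 r : R, r < 1 & K `<=` cball nu z r.
Proof.
move=> /ereal_inf_lt[_ [r [_ [z Kr]] <-]]; rewrite lte_fin => r1.
by exists z, r.
Qed.

Lemma sub_ball_hull_of_b_exp (R : realType) (n : nat) (nu : 'rV[R]_n -> R)
    (K S : set 'rV[R]_n) :
  is_norm nu -> strictly_convex nu -> compact K -> b_bounded nu K ->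
  b_exp nu K `<=` closure S -> K `<=` ball_hull nu S.
Proof.
move=> hnu hsc cK /b_bounded_sub_ball[z [r r1 Kr]] bS p Kp c Sc.
have [//|cp] := leP (nu (c - p)) 1.
have [y /bS Sy cy] :=
  exists_b_exp_outside_ball hnu hsc cK Kr r1 Kp cp.
have /closure_subset/(_ _ Sy) := Sc.
rewrite -((closure_id _).1 (closed_cball (x := c) (r := 1) hnu)).
by rewrite /cball /closed_ball_ /= leNgt cy.
Qed.

(** A b-exposed point that [S] does not approach can be cut off by moving the
    centre [x] of its supporting sphere to [x + d (x - x0)], where [d] is the
    gap between the sphere and [closure S]. *)
Lemma b_exp_sub_closure (R : realType) (n : nat) (nu : 'rV[R]_n -> R)
    (K S : set 'rV[R]_n) :
  is_norm nu -> compact K -> closed K -> S `<=` K -> K `<=` ball_hull nu S ->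
  b_exp nu K `<=` closure S.
Proof.
move=> hnu cK clK SK KS x0 [x [Kx _] x0E]; apply: contrapT => nSx0.
have [Kx0 xx0] : K x0 /\ nu (x - x0) = 1.
  by have : [set x0] x0 by []; rewrite x0E.
have clSK : closure S `<=` K.
  by rewrite [X in _ `<=` X]((closure_id _).1 clK); exact: closure_subset.
have [d d0 Sd] : exists2 d : R, 0 < d & S `<=` cball nu x (1 - d).
  have [S0|S0] := pselect (closure S !=set0); last first.
    (* for [S] empty every gap works *)
    exists 1 => // y Sy; exfalso; apply: S0; exists y; exact: subset_closure.
  have [y Sy ymax] := compact_farthest x hnu
    (subclosed_compact (@closed_closure _ S) cK clSK) S0.
  exists (1 - nu (x - y)); last first.
    move=> w /subset_closure/ymax; rewrite /cball /closed_ball_ /=; lra.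
  rewrite subr_gt0 lt_neqAle (Kx _ (clSK _ Sy)) andbT; apply/eqP => xy.
  apply: nSx0; have : (K `&` sphere nu x 1) y by split=> //; exact: clSK.
  by rewrite -x0E => <-.
have : cball nu (x + d *: (x - x0)) 1 x0.
  apply: KS Kx0 _ _ => w /Sd; rewrite /cball /closed_ball_ /= => xw.
  rewrite addrAC; apply: le_trans (norm_triangle hnu _ _) _.
  by rewrite (norm_homog hnu) xx0 gtr0_norm //; lra.
rewrite /cball /closed_ball_ /=.
have -> : x + d *: (x - x0) - x0 = (1 + d) *: (x - x0).
  by rewrite scalerDl scale1r addrAC.
by rewrite (norm_homog hnu) xx0 gtr0_norm; lra.
Qed.

Theorem theorem4 (R : realType) (n : nat) (hn : (0 < n)%N)
    (nu : 'rV[R]_n -> R) (hnu : is_norm nu) (hsc : strictly_convex nu)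
    (K : set 'rV[R]_n) (hK : b_convex_body nu K) (hb : b_bounded nu K) :
  [/\ forall S : set 'rV[R]_n, S `<=` K ->
        (ball_hull nu S = K <-> b_exp nu K `<=` closure S),
      K = ball_hull nu (b_exp nu K) &
      forall C : set 'rV[R]_n,
        minimal_closed_generator nu K C <-> C = closure (b_exp nu K)].
Proof.
have [bK _ KE] := hK.
have clK : closed K by rewrite KE; exact: closed_ball_hull.
have cK : compact K by exact: norm_bounded_closed_compact bK clK.
have bexpK : b_exp nu K `<=` K.
  by move=> y [x _ yE]; have [] : (K `&` sphere nu x 1) y by rewrite -yE.
have iffS (S : set 'rV[R]_n) : S `<=` K ->
    (ball_hull nu S = K <-> b_exp nu K `<=` closure S).
  move=> SK; split=> [SE|bS].
    by apply: b_exp_sub_closure => //; rewrite SE.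
  apply/seteqP; split; last exact: sub_ball_hull_of_b_exp.
  by rewrite [X in _ `<=` X]KE; exact: ball_hullS.
split=> //; first by apply/esym/(iffS _ bexpK).2; exact: subset_closure.
pose E := closure (b_exp nu K).
have EK : E `<=` K.
  by rewrite [X in _ `<=` X]((closure_id _).1 clK); exact: closure_subset.
have Eclosed : closed E by exact: closed_closure.
have Ehull : ball_hull nu E = K.
  apply/(iffS _ EK).2; rewrite -((closure_id _).1 Eclosed).
  exact: subset_closure.
(* every closed generator contains [E], so [E] is even the least one *)
have Emin D : closed D -> ball_hull nu D = K -> E `<=` D.
  move=> cD DE; have DK : D `<=` K by rewrite -DE; exact: sub_ball_hull.
  rewrite [X in _ `<=` X]((closure_id _).1 cD).
  rewrite ((closure_id _).1 (@closed_closure _ D)); apply: closure_subset.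
  exact/(iffS _ DK).1.
move=> C; split=> [[cC CE Cmin]|->].
  by apply/esym/Cmin => //; exact: Emin.
by split=> // D cD DE DsubE; apply/seteqP; split=> //; exact: Emin.
Qed.
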